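(* Let $n,\ell$ be positive integers. There exists a graph $G_{n,\ell}$ of distance VC-dimension at most $18$ such that the $2$VC-dimension of the $B_\ell$-hypergraph of $G_{n,\ell}$ is at least $n$.
   Context: All graphs are finite and simple; $d_G$ is the shortest-path distance ($+\infty$ between different components) and $B_G(x,k)=\{y: d_G(x,y)\le k\}$. The $B_\ell$-hypergraph of $G=(V,E)$ has vertex set $V$ and one hyperedge $B_G(v,\ell)$ for each $v\in V$; the $B$-hypergraph has as hyperedges all balls $B_G(v,k)$, $v\in V$, $k\ge 0$ integer. A set $X$ is shattered (resp. $2$-shattered) by a hypergraph if for every $X'\subseteq X$ (resp. every $X'\subseteq X$ with $|X'|=2$) there is a hyperedge $e$ with $e\cap X=X'$. The VC-dimension (resp. $2$VC-dimension) is the maximum size of a shattered (resp. $2$-shattered) set. The distance VC-dimension of a graph $G$ is the maximum, over all induced subgraphs $G'$ of $G$, of the VC-dimension of the $B$-hypergraph of $G'$. *)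

(* Defs.v *)
From mathcomp Require Import all_boot.

Set Implicit Arguments.
Unset Strict Implicit.
Unset Printing Implicit Defensive.

Record sgraph := SGraph {
  vertex :> finType;
  adj : rel vertex;
  adj_sym : symmetric adj;
  adj_irrefl : irreflexive adj }.

Section Induced.
Variables (G : sgraph) (S : {set G}).

Definition induced_vertex := {x : G | x \in S}.
Definition induced_adj : rel induced_vertex :=
  fun x y => adj (val x) (val y).

Lemma induced_adj_sym : symmetric induced_adj.
Proof. by move=> x y; apply: adj_sym. Qed.

Lemma induced_adj_irrefl : irreflexive induced_adj.
Proof. by move=> x; apply: adj_irrefl. Qed.

Definition induced : sgraph := SGraph induced_adj_sym induced_adj_irrefl.

End Induced.

Section Distance.
Variable G : sgraph.
Implicit Types (x y : G) (k : nat).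

Definition walk_of_length x y k :=
  [exists p : k.-tuple G, path (@adj G) x p && (last x p == y)].

Lemma walk_of_lengthP x y k :
  reflect (exists p, [/\ path (@adj G) x p, last x p = y & size p = k])
          (walk_of_length x y k).
Proof.
apply: (iffP existsP) => [[p /andP[hp /eqP hl]]|[p [hp hl hs]]].
  by exists p; rewrite size_tuple.
by exists (tcast hs (in_tuple p)); rewrite val_tcast hp hl /=.
Qed.

Lemma connect_walk x y :
  connect (@adj G) x y -> exists k, walk_of_length x y k.
Proof.
move/connectP=> [p hp hl].
by exists (size p); apply/walk_of_lengthP; exists p.
Qed.

(* [None] stands for [+oo]. *)
Definition dist x y : option nat :=
  if @idP (connect (@adj G) x y) is ReflectT c
  then Some (ex_minn (connect_walk c)) else None.

Definition ball x k : {set G} :=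
  [set y | if dist x y is Some d then d <= k else false].

Lemma in_ball x y k :
  reflect (exists2 j, j <= k & walk_of_length x y j) (y \in ball x k).
Proof.
rewrite inE /dist; case: {-}_ / idP => [c|nc].
  case: ex_minnP => d hd dmin; apply: (iffP idP) => [dk|[j jk /dmin dj]].
    by exists d.
  exact: leq_trans dj jk.
apply: (iffP idP) => // -[j _ /walk_of_lengthP[p [hp hl _]]].
by case: nc; apply/connectP; exists p.
Qed.

Lemma ball_truncate x k : ball x (minn k #|G|.-1) = ball x k.
Proof.
apply/setP=> y; apply/in_ball/in_ball => -[j jk hj].
  by exists j => //; apply: leq_trans jk (geq_minl _ _).
have /walk_of_lengthP[p [hp hl hs]] := hj.
case: (shortenP hp) hl => q hq uq sq hl.
exists (size q); last by apply/walk_of_lengthP; exists q.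
rewrite leq_min; apply/andP; split.
  apply: leq_trans jk; rewrite -hs; apply: uniq_leq_size => //.
  by case/andP: uq.
have := max_card (mem (x :: q)); rewrite (card_uniqP uq) /=.
by case: #|G|.
Qed.

End Distance.

(* A hypergraph on [V] is given by its set of hyperedges. *)
Notation hypergraph V := {set {set V}}.

Definition ball_hypergraph_at (G : sgraph) (l : nat) : hypergraph G :=
  [set ball v l | v : G].

(* Restricting to radii below [#|G|] loses no ball: see [ball_hypergraphP]. *)
Definition ball_hypergraph (G : sgraph) : hypergraph G :=
  [set ball v k | v : G, k : 'I_#|G|].

Lemma ball_hypergraphP (G : sgraph) (e : {set G}) :
  reflect (exists (v : G) (k : nat), e = ball v k) (e \in ball_hypergraph G).
Proof.
apply: (iffP imset2P) => [[v k _ _ ->]|[v [k ->]]]; first by exists v, k.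
have lt_k : minn k #|G|.-1 < #|G|.
  have G_gt0 : 0 < #|G| by apply/card_gt0P; exists v.
  by rewrite -[X in _ < X](prednK G_gt0) ltnS geq_minr.
by exists v (Ordinal lt_k); rewrite //= ball_truncate.
Qed.

Section VCDimension.
Variables (V : finType) (H : hypergraph V).

Definition shattered (X : {set V}) : bool :=
  [forall (X' : {set V} | X' \subset X), exists e in H, e :&: X == X'].

Definition two_shattered (X : {set V}) : bool :=
  [forall (X' : {set V} | (X' \subset X) && (#|X'| == 2)),
     exists e in H, e :&: X == X'].

Definition VC_dim : nat := \max_(X : {set V} | shattered X) #|X|.

Definition two_VC_dim : nat := \max_(X : {set V} | two_shattered X) #|X|.

End VCDimension.

Definition distance_VC_dim (G : sgraph) : nat :=
  \max_(S : {set G}) VC_dim (ball_hypergraph (induced S)).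

(* Main.v *)
Require Import Defs.
From mathcomp Require Import all_boot.
From mathcomp Require Import zify.

(* The graph is a clique x_1, ..., x_n with a pendant path ("leg") with l vertices
   starting at each x_i, together with an independent set of vertices e, one for
   each set of indices, adjacent to the x_i with i in e when #|e| <= 2.  The tips
   of the legs are 2-shattered by the balls of radius l around the pairs e.

   Let Z be shattered by the balls of an induced subgraph.  All distances between
   vertices of Z are finite, so balls are explicit.  A ball is convex along a leg,
   so Z has at most 2 vertices per leg.  On vertices of distinct legs, a ball is
   determined by a height threshold, except on the leg of its center, or by two
   consecutive thresholds, the larger one used on at most 2 legs (those adjacent
   to its center e); hence Z meets at most 4 legs.  On the vertices e of Z, a ball
   containing at least 2 of them but not all is the set of e meeting some Y with
   #|Y| <= 2; hence Z contains at most 7 of them, and #|Z| <= 7 + 4 * 2. *)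
Set Implicit Arguments.
Unset Strict Implicit.
Unset Printing Implicit Defensive.

Section Balls.
Variable G : sgraph.
Implicit Types (x y z w : G) (j k m : nat).

Lemma ball_refl x k : x \in ball x k.
Proof. by apply/in_ball; exists 0 => //; apply/walk_of_lengthP; exists [::]. Qed.

Lemma ball0P x y : reflect (y = x) (y \in ball x 0).
Proof.
apply: (iffP idP) => [/in_ball[j]|->]; last exact: ball_refl.
by rewrite leqn0 => /eqP-> /walk_of_lengthP[p [_ <- /size0nil->]].
Qed.


Lemma ballSP x y k :
  reflect (y = x \/ exists2 z, adj x z & y \in ball z k) (y \in ball x k.+1).
Proof.
apply: (iffP idP) => [/in_ball[j jk]|[->|[z xz /in_ball[j jk]]]].
- case/walk_of_lengthP=> -[|z p] [/= xp lp sp]; first by left.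
  case/andP: xp => xz zp.
  right; exists z => //; apply/in_ball; exists (size p); first by rewrite -ltnS sp.
  by apply/walk_of_lengthP; exists p.
- exact: ball_refl.
- case/walk_of_lengthP=> p [zp lp sp]; apply/in_ball; exists j.+1 => //.
  by apply/walk_of_lengthP; exists (z :: p); rewrite /= xz zp lp sp.
Qed.


Lemma ball1 x y : adj x y -> y \in ball x 1.
Proof. by move=> xy; apply/ballSP; right; exists y => //; apply: ball_refl. Qed.

Lemma ball_le x y j k : j <= k -> y \in ball x j -> y \in ball x k.
Proof.
by move=> jk /in_ball[i ij w]; apply/in_ball; exists i => //; apply: leq_trans jk.
Qed.

Lemma ball_trans y x z j k :
  y \in ball x j -> z \in ball y k -> z \in ball x (j + k).
Proof.
elim: j x => [|j IHj] x; first by move=> /ball0P ->.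
case/ballSP=> [->|[w xw yw] zy]; first exact: ball_le (leq_addl _ _).
by rewrite addSn; apply/ballSP; right; exists w => //; apply: IHj.
Qed.

Lemma ball_sym x y k : (y \in ball x k) = (x \in ball y k).
Proof.
suff sub (a b : G) : b \in ball a k -> a \in ball b k by apply/idP/idP; apply: sub.
elim: k a b => [|k IHk] a b; first by move=> /ball0P ->; apply: ball_refl.
case/ballSP=> [->|[z az /IHk zb]]; first exact: ball_refl.
by rewrite -addn1; apply: ball_trans zb _; apply: ball1; rewrite adj_sym.
Qed.

Lemma ball_separator (U P : pred G) x y k :
    (forall a b, U a -> ~~ U b -> adj a b -> P b) ->
    U x -> ~~ U y -> y \in ball x k ->
  exists z j m, [/\ P z, z \in ball x j, y \in ball z m, 0 < j & j + m <= k].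
Proof.
move=> sepP; elim: k x => [|k IHk] x Ux Uy.
  by move=> /ball0P eyx; rewrite eyx Ux in Uy.
case/ballSP=> [eyx|[w xw yw]]; first by rewrite eyx Ux in Uy.
case Uw: (U w); last first.
  by exists w, 1, k; split=> //; [apply: (sepP x) => //; rewrite Uw|apply: ball1].
have [z [j [m [Pz zw yz j0 jm]]]] := IHk w Uw Uy yw.
by exists z, j.+1, m; split=> //; apply/ballSP; right; exists w.
Qed.

End Balls.

Section FiniteSets.
Variables T U : finType.
Implicit Types (f : T -> U) (A : {set T}).

Lemma card_le_fibers f A m :
  (forall u, #|[set x in A | f x == u]| <= m) -> #|A| <= #|f @: A| * m.
Proof.
move=> fib; rewrite -sum1_card (partition_big_imset f) /= -sum_nat_const.
apply: leq_sum => u _; apply: leq_trans (fib u).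
by rewrite -sum1_card big_mkcond [X in _ <= X]big_mkcond leq_sum //= => x _; rewrite inE.
Qed.

Lemma imset_sorted_reps f (ht : T -> nat) A m : m <= #|f @: A| ->
  exists s, [/\ uniq (map f s), size s = m, {subset s <= A} & sorted (relpre ht leq) s].
Proof.
case/card_geqP=> t [t_uniq <- tA].
have [s [st sA]] : exists s, map f s = t /\ {subset s <= A}.
  elim: t tA {t_uniq} => [|u t IHt] tA; first by exists [::].
  have /imsetP[x xA ->] := tA u (mem_head _ _).
  have [v vt|s [<- sA]] := IHt; first by apply: tA; rewrite in_cons vt orbT.
  exists (x :: s); split=> // y; rewrite in_cons => /predU1P[->//|]; exact: sA.
rewrite -st in t_uniq *; exists (sort (relpre ht leq) s); split.
- by rewrite (perm_uniq (perm_map f (permEl (perm_sort _ _)))).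
- by rewrite size_sort size_map.
- by move=> x; rewrite mem_sort; apply: sA.
- by apply: sort_sorted => x y; apply: leq_total.
Qed.

Lemma card_bigcup_le (B : {set U}) (F : U -> {set T}) :
  #|\bigcup_(u in B) F u| <= \sum_(u in B) #|F u|.
Proof.
elim/big_rec2: _ => [|u m X _ le]; first by rewrite cards0.
by apply: leq_trans (leq_card_setU _ _) _; rewrite leq_add2l.
Qed.

End FiniteSets.

Section LeggedClique.
Variables n l : nat.

Definition legged_vertex : finType := (('I_n * 'I_l) + {set 'I_n})%type.

(* (i, h) is the vertex of leg i at distance h from the clique. *)
Definition legged_adj : rel legged_vertex := fun u v =>
  match u, v with
  | inl (i, h), inl (j, k) =>
    if i == j then (h.+1 == k) || (k.+1 == h) else (h == 0 :> nat) && (k == 0 :> nat)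
  | inl (i, h), inr e | inr e, inl (i, h) =>
    [&& h == 0 :> nat, i \in e & #|e| <= 2]
  | inr _, inr _ => false
  end.

Lemma legged_adj_sym : symmetric legged_adj.
Proof.
move=> [[i h]|e] [[j k]|f] //=. rewrite [j == i]eq_sym; case: ifP => _.
  by rewrite orbC.
by rewrite andbC.
Qed.

Lemma legged_adj_irrefl : irreflexive legged_adj.
Proof. by move=> [[i h]|e] //=; rewrite eqxx; lia. Qed.

Definition legged_clique : sgraph := SGraph legged_adj_sym legged_adj_irrefl.

Definition on_leg i (u : legged_vertex) : bool :=
  if u is inl (j, _) then j == i else false.

Definition at_leg i (h : nat) (u : legged_vertex) : bool :=
  if u is inl (j, k) then (j == i) && (k == h :> nat) else false.

Definition above_leg i (h : nat) (u : legged_vertex) : bool :=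
  if u is inl (j, k) then (j == i) && (h < k) else false.

Lemma at_leg_inj i h u v : at_leg i h u -> at_leg i h v -> u = v.
Proof.
case: u v => [[i1 h1]|e] [[i2 h2]|f] //= /andP[/eqP-> /eqP e1] /andP[/eqP-> /eqP e2].
by congr (inl (_, _)); apply: val_inj; rewrite /= e1.
Qed.

Lemma at_leg_on i h u : at_leg i h u -> on_leg i u.
Proof. by case: u => // -[j k] /andP[]. Qed.

Lemma on_leg_at i u : on_leg i u -> exists h, at_leg i h u.
Proof. by case: u => // -[j k] /= ->; exists k; rewrite eqxx. Qed.

Lemma above_leg_adj i h u v :
  above_leg i h u -> ~~ above_leg i h v -> legged_adj u v -> at_leg i h v.
Proof.
case: u v => [[i1 h1]|e] [[i2 h2]|f] //= /andP[/eqP-> lt1]; last by lia.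
by rewrite eq_sym; case: eqP => _ /=; lia.
Qed.

Lemma at_leg_index i j h k u : at_leg i h u -> at_leg j k u -> i = j.
Proof. by case: u => // -[? ?] /= /andP[/eqP-> _] /andP[/eqP-> _]. Qed.

Lemma at_leg_off i j h u : i != j -> at_leg i h u -> ~~ on_leg j u.
Proof. by move=> ij; case: u => // -[? ?] /= /andP[/eqP-> _]. Qed.

Lemma at_leg0_adj i j u v :
  at_leg i 0 u -> at_leg j 0 v -> i != j -> legged_adj u v.
Proof.
case: u v => [[? ?]|//] [[? ?]|//] /= /andP[/eqP-> ->] /andP[/eqP-> ->] ij.
by rewrite (negbTE ij).
Qed.

Section Subgraph.
Variables (H : sgraph) (phi : H -> legged_clique).
Hypothesis phi_inj : injective phi.
Hypothesis phi_adj : forall x y, adj x y = legged_adj (phi x) (phi y).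
Implicit Types (x y z a b c r : H) (i j : 'I_n) (h k m : nat).

Lemma at_leg_uniq i h x y : at_leg i h (phi x) -> at_leg i h (phi y) -> x = y.
Proof. by move=> xi yi; apply: phi_inj; apply: at_leg_inj xi yi. Qed.

Lemma leg_separator i h x y k :
    above_leg i h (phi x) -> ~~ above_leg i h (phi y) -> y \in ball x k ->
  exists z d m, [/\ at_leg i h (phi z), z \in ball x d, y \in ball z m,
                    0 < d & d + m <= k].
Proof.
pose U z := above_leg i h (phi z); pose P z := at_leg i h (phi z).
have sepP a b : U a -> ~~ U b -> adj a b -> P b.
  by rewrite phi_adj; apply: above_leg_adj.
exact: (ball_separator sepP).
Qed.

Lemma leg_root i h x y k :
    at_leg i h (phi x) -> ~~ on_leg i (phi y) -> y \in ball x k ->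
  exists r, [/\ at_leg i 0 (phi r), x \in ball r h, h <= k & y \in ball r (k - h)].
Proof.
elim: h x k => [|h IHh] x k xi yi yx.
  by exists x; rewrite subn0; split=> //; apply: ball_refl.
have [||z [j [m [zi zx yz j0 jm]]]] := leg_separator (i := i) (h := h) _ _ yx.
- by case: (phi x) xi => // -[? ?] /= /andP[-> /eqP->] /=.
- by apply: contra yi; case: (phi y) => // -[? ?] /= /andP[].
have [r [ri zr hm yr]] := IHh z m zi yi yz.
have lt : h < k by move: hm j0 jm; clear; lia.
exists r; split=> //; last first.
  by apply: ball_le yr; move: j0 jm; clear; lia.
rewrite -addn1; apply: ball_trans zr _; apply: ball1; rewrite phi_adj.
case: (phi x) (phi z) xi zi => [[? ?]|//] [[? ?]|//] /=.
by move=> /andP[/eqP-> /eqP->] /andP[/eqP-> /eqP->]; rewrite !eqxx.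
Qed.

Lemma leg_convex i h1 h2 h3 x1 x2 x3 c k :
    at_leg i h1 (phi x1) -> at_leg i h2 (phi x2) -> at_leg i h3 (phi x3) ->
    h1 < h2 -> h2 < h3 ->
  x1 \in ball c k -> x3 \in ball c k -> x2 \in ball c k.
Proof.
move=> x1i x2i x3i h12 h23 x1c x3c.
have x1U : ~~ above_leg i h2 (phi x1).
  by case: (phi x1) x1i => // -[? ?] /= /andP[-> /eqP->]; lia.
have x3U : above_leg i h2 (phi x3) by case: (phi x3) x3i => // -[? ?] /= /andP[-> /eqP->].
case cU: (above_leg i h2 (phi c)).
  have [z [j [m [zi zc _ _ jm]]]] := leg_separator cU x1U x1c.
  by rewrite (at_leg_uniq x2i zi); apply: ball_le zc; apply: leq_trans (leq_addr _ _) jm.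
rewrite ball_sym in x3c.
have [z [j [m [zi _ cz _ jm]]]] := leg_separator x3U (negbT cU) x3c.
rewrite (at_leg_uniq x2i zi) ball_sym.
exact: ball_le (leq_trans (leq_addl _ _) jm) cz.
Qed.

Lemma leg_to_leg i0 i j h m c b a r k :
    on_leg i0 (phi c) -> i != i0 -> j != i0 ->
    at_leg i h (phi b) -> b \in ball c k ->
    at_leg j 0 (phi r) -> a \in ball r m -> m <= h ->
  a \in ball c k.
Proof.
move=> /on_leg_at[h0 c0] ii0 ji0 bi bc rj ar mh.
have bi0 : ~~ on_leg i0 (phi b) by apply: at_leg_off ii0 bi.
have [r0 [r00 cr0 h0k br0]] := leg_root c0 bi0 bc.
have r0i : ~~ on_leg i (phi r0) by apply: at_leg_off r00; rewrite eq_sym.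
rewrite ball_sym in br0.
have [r' [r'i _ hk r0r']] := leg_root bi r0i br0.
have lt : h0 + (1 + m) <= k.
  case E: (k - h0 - h) r0r' => [|d]; last by move: E h0k hk mh; clear; lia.
  by move/ball0P=> er; rewrite er (at_leg_on r'i) in r0i.
apply: (ball_le lt); rewrite ball_sym in cr0; apply: ball_trans cr0 _.
apply: ball_trans ar; apply: ball1; rewrite phi_adj.
by apply: at_leg0_adj r00 rj _; rewrite eq_sym.
Qed.

Lemma set_nbr c e y k :
    phi c = inr e -> y \in ball c k -> y != c ->
  exists i z, [/\ at_leg i 0 (phi z), i \in e, #|e| <= 2, z \in ball c 1
                & 0 < k /\ y \in ball z k.-1].
Proof.
move=> ce; case: k => [|k]; first by move/ball0P=> ->; rewrite eqxx.
case/ballSP=> [->|[z cz yz] _]; first by rewrite eqxx.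
have := cz; rewrite phi_adj ce /=; case E: (phi z) => [[i h]|//] /and3P[/eqP h0 ie e2].
by exists i, z; rewrite E /= eqxx h0; split=> //; apply: ball1.
Qed.

Lemma set_nbr_at c e i r :
    phi c = inr e -> i \in e -> #|e| <= 2 -> at_leg i 0 (phi r) ->
  r \in ball c 1.
Proof.
move=> ce ie e2 ri; apply: ball1; rewrite phi_adj ce.
by case: (phi r) ri => // -[j h] /= /andP[/eqP-> ->]; rewrite ie e2.
Qed.

Lemma roots_ball i j r r' :
  at_leg i 0 (phi r) -> at_leg j 0 (phi r') -> r' \in ball r 1.
Proof.
move=> ri rj; have [eij|ij] := eqVneq i j.
  by rewrite eij in ri; rewrite (at_leg_uniq ri rj); apply: ball_refl.
by apply: ball1; rewrite phi_adj; apply: at_leg0_adj ri rj ij.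
Qed.

Lemma legs_trace ia ip iq iu iv ha hp hq hu hv a p q u v c k K :
    at_leg ia ha (phi a) -> at_leg ip hp (phi p) -> at_leg iq hq (phi q) ->
    at_leg iu hu (phi u) -> at_leg iv hv (phi v) ->
    uniq [:: ia; ip; iq; iu; iv] ->
    hp <= hq -> [&& ha <= hq, ha <= hu & ha <= hv] -> p \in ball a K ->
    q \in ball c k -> u \in ball c k -> v \in ball c k ->
  (a \in ball c k) || (p \in ball c k).
Proof.
move=> aL pL qL uL vL; rewrite /= !in_cons !in_nil !orbF !negb_or -!andbA.
case/and5P=> iap iaq iau iav /and5P[ipq ipu ipv iqu /and3P[iqv iuv _]].
move=> hpq /and3P[haq hau hav] pa qc uc vc.
have pia : ~~ on_leg ia (phi p) by apply: at_leg_off pL; rewrite eq_sym.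
have aip : ~~ on_leg ip (phi a) by apply: at_leg_off aL.
have [ra [raL ara _ _]] := leg_root aL pia pa.
rewrite ball_sym in pa; have [rp [rpL prp _ _]] := leg_root pL aip pa.
(* A ball centered on leg ia that contains q contains p; any other ball that
   contains q, u and v contains a. *)
case E: (phi c) => [[i0 h0]|e].
  have cL : on_leg i0 (phi c) by rewrite E /= eqxx.
  have [ei|ai0] := eqVneq ia i0.
    apply/orP; right; subst i0.
    by apply: leg_to_leg cL _ _ qL qc rpL prp hpq; rewrite eq_sym.
  apply/orP; left; have [ei|qi0] := eqVneq iq i0.
    subst i0; apply: leg_to_leg cL _ _ uL uc raL ara hau; by rewrite // eq_sym.
  exact: leg_to_leg cL qi0 ai0 qL qc raL ara haq.
apply/orP; left.
have key i h b : at_leg i h (phi b) -> b \in ball c k -> i \notin e -> ha <= h ->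
    a \in ball c k.
  move=> bL bc ie hah.
  have ci : ~~ on_leg i (phi c) by rewrite E.
  rewrite ball_sym in bc; have [r [rL _ hk]] := leg_root bL ci bc.
  rewrite ball_sym => rc.
  have rNc : r != c by apply: contraTneq rL => ->; rewrite E.
  have [j [z [zL je _ zc [k0 rz]]]] := set_nbr E rc rNc.
  have lt : 1 + (1 + ha) <= k.
    case F: (k - h).-1 rz => [|d]; last by move: F hk hah; clear; lia.
    move/ball0P=> er; rewrite er in rL.
    by rewrite (at_leg_index rL zL) je in ie.
  apply: (ball_le lt); apply: ball_trans zc _; apply: ball_trans ara.
  exact: roots_ball zL raL.
have [qe|qe] := boolP (iq \in e); last exact: key qL qc qe haq.
have [ue|ue] := boolP (iu \in e); last exact: key uL uc ue hau.
have [ve|ve] := boolP (iv \in e); last exact: key vL vc ve hav.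
have qNc : q != c by apply: contraTneq qL => ->; rewrite E.
have [j [z [_ _ e2 _ _]]] := set_nbr E qc qNc.
have /card_geqP : exists s, [/\ uniq s, size s = 3 & {subset s <= e}].
  exists [:: iq; iu; iv]; split=> //; first by rewrite /= !inE negb_or iqu iqv iuv.
  by move=> x; rewrite !inE => /or3P[] /eqP->.
by rewrite ltnNge e2.
Qed.

Definition is_set x := if phi x is inr _ then true else false.
Definition set_at x : {set 'I_n} := if phi x is inr e then e else set0.

Lemma is_setE x : is_set x -> phi x = inr (set_at x).
Proof. by rewrite /is_set /set_at; case: (phi x). Qed.

Lemma set_off_leg i x : is_set x -> ~~ on_leg i (phi x).
Proof. by rewrite /is_set; case: (phi x). Qed.

Lemma set_trace (B : {set H}) c k b1 b2 b3 :
    {in B, forall b, is_set b} ->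
    (forall b b', b \in B -> b' \in B -> exists K, b' \in ball b K) ->
    b1 \in B -> b2 \in B -> b3 \in B -> b1 != b2 ->
    b1 \in ball c k -> b2 \in ball c k -> b3 \notin ball c k ->
  exists2 Y : {set 'I_n}, #|Y| <= 2 &
    {in B, forall b, (b \in ball c k) = [exists y in Y, y \in set_at b]}.
Proof.
move=> Bset Bconn b1B b2B b3B b12 b1c b2c b3c.
have nbr b : b \in B -> exists i z,
    [/\ at_leg i 0 (phi z), i \in set_at b, #|set_at b| <= 2 & z \in ball b 1].
  move=> bB; have [b' b'B b'b] : exists2 b', b' \in B & b' != b.
    have [eb|] := eqVneq b1 b; last by exists b1.
    by exists b2 => //; rewrite -eb eq_sym.
  have [K b'K] := Bconn _ _ bB b'B.
  have [i [z [zL ib b2' zb _]]] := set_nbr (is_setE (Bset _ bB)) b'K b'b.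
  by exists i, z.
have [i3 [z3 [z3L i3b3 _ z3b3]]] := nbr _ b3B.
case E: (phi c) => [[i0 h0]|e].
  have cL : at_leg i0 h0 (phi c) by rewrite E /= !eqxx.
  have [r [rL cr h0k b1r]] := leg_root cL (set_off_leg i0 (Bset _ b1B)) b1c.
  exists [set i0]; first by rewrite cards1.
  have rNset b : b \in B -> r != b.
    move=> bB; apply: contraTneq (at_leg_on rL) => ->; exact: set_off_leg (Bset _ bB).
  move=> b bB; apply/idP/exists_inP=> [bc|[y /set1P-> ib]].
    exists i0; rewrite ?set11 //; apply: contraNT b3c => i0b.
    have [r' [r'L _ _ br]] := leg_root cL (set_off_leg i0 (Bset _ bB)) bc.
    rewrite (at_leg_uniq r'L rL) ball_sym in br.
    have [j [z [zL jb _ _ [m0 rz]]]] := set_nbr (is_setE (Bset _ bB)) br (rNset _ bB).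
    have lt : h0 + (1 + 1) <= k.
      case F: (k - h0).-1 rz => [|d]; last by move: F h0k; clear; lia.
      move/ball0P=> er; rewrite er in rL.
      by rewrite (at_leg_index rL zL) jb in i0b.
    apply: (ball_le lt); rewrite ball_sym in cr; apply: ball_trans cr _.
    rewrite ball_sym in z3b3; apply: ball_trans z3b3; exact: roots_ball rL z3L.
  have [_ [_ [_ _ b2' _]]] := nbr _ bB.
  have lt : h0 + 1 <= k.
    case F: (k - h0) b1r => [|d]; last by move: F h0k; clear; lia.
    by move/ball0P=> er; have := rNset _ b1B; rewrite er eqxx.
  apply: (ball_le lt); rewrite ball_sym in cr; apply: ball_trans cr _.
  by rewrite ball_sym; apply: set_nbr_at (is_setE (Bset _ bB)) ib b2' rL.
have [b [bB bc bNc]] : exists b, [/\ b \in B, b \in ball c k & b != c].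
  have [eb|] := eqVneq b1 c; last by exists b1.
  by exists b2; split=> //; rewrite -eb eq_sym.
have [i [z [zL ie e2 zc [k0 bz]]]] := set_nbr E bc bNc.
have k2 : 2 <= k.
  case F: k.-1 bz => [|d]; last by move: F; clear; lia.
  move/ball0P=> eb; have := set_off_leg i (Bset _ bB).
  by rewrite eb (at_leg_on zL).
exists [set j in e | [exists r, at_leg j 0 (phi r)]].
  apply: leq_trans e2; apply: subset_leq_card; apply/subsetP=> j.
  by rewrite inE => /andP[].
move=> d dB; apply/idP/exists_inP=> [dc|[j]]; last first.
  rewrite inE => /andP[je /existsP[r rL]] jd.
  have [_ [_ [_ _ d2 _]]] := nbr _ dB.
  apply: (ball_le (k2 : 1 + 1 <= k)); apply: ball_trans (set_nbr_at E je e2 rL) _.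
  by rewrite ball_sym; apply: set_nbr_at (is_setE (Bset _ dB)) jd d2 rL.
have iY : i \in [set j in e | [exists r, at_leg j 0 (phi r)]].
  by rewrite inE ie; apply/existsP; exists z.
have [eb|dNc] := eqVneq d c.
  by exists i => //; rewrite /set_at eb E.
have [i' [z' [z'L i'e _ z'c [_ dz']]]] := set_nbr E dc dNc.
have z'Nd : z' != d.
  by apply: contraTneq (at_leg_on z'L) => ->; exact: set_off_leg (Bset _ dB).
rewrite ball_sym in dz'.
have [j [w [wL jd _ _ [k1 z'w]]]] := set_nbr (is_setE (Bset _ dB)) dz' z'Nd.
exists j => //; apply: contraNT b3c => jY.
have lt : 1 + (1 + 1) <= k.
  case F: k.-1.-1 z'w => [|m]; last by move: F; clear; lia.
  move/ball0P=> ez; rewrite ez in z'L; move: jY.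
  rewrite inE (at_leg_index wL z'L) i'e /=; case/negP; apply/existsP.
  by exists w; rewrite (at_leg_index z'L wL).
apply: (ball_le lt); apply: ball_trans zc _.
rewrite ball_sym in z3b3; apply: ball_trans z3b3; exact: roots_ball zL z3L.
Qed.

Section Shattered.
Variable Z : {set H}.
Hypothesis Z_cut : forall X : {set H}, X \subset Z ->
  exists c k, {in Z, forall z, (z \in ball c k) = (z \in X)}.

Lemma cut_connected z z' : z \in Z -> z' \in Z -> exists K, z' \in ball z K.
Proof.
move=> zZ z'Z; have [c [k cZ]] := Z_cut (subxx Z).
by exists (k + k); apply: (@ball_trans _ c); [rewrite ball_sym|]; rewrite cZ.
Qed.

Definition leg_of x := if phi x is inl (i, _) then Some i else None.
Definition height x : nat := if phi x is inl (_, h) then h else 0.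

Lemma leg_ofP x i : leg_of x = Some i -> at_leg i (height x) (phi x).
Proof. by rewrite /leg_of /height; case: (phi x) => // -[j h] [->] /=; rewrite !eqxx. Qed.

Lemma card_leg_fiber i : #|[set x in Z | leg_of x == Some i]| <= 2.
Proof.
rewrite leqNgt; apply/negP; rewrite -(card_imset _ (@inj_id _)).
case/(imset_sorted_reps height)=> s [].
case: s => [|x1 [|x2 [|x3 [|? ?]]]] // + _ sZ.
rewrite map_id /= !in_cons !negb_or => /and3P[/and3P[x12 x13 _] /andP[x23 _] _].
have sZi x : x \in [:: x1; x2; x3] -> x \in Z /\ at_leg i (height x) (phi x).
  by move/sZ; rewrite in_set => /andP[xZ /eqP/leg_ofP].
have [x1Z x1L] : _ /\ _ := sZi x1 ltac:(by rewrite !in_cons eqxx ?orbT).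
have [x2Z x2L] : _ /\ _ := sZi x2 ltac:(by rewrite !in_cons eqxx ?orbT).
have [x3Z x3L] : _ /\ _ := sZi x3 ltac:(by rewrite !in_cons eqxx ?orbT).
have lt x y : at_leg i (height x) (phi x) -> at_leg i (height y) (phi y) ->
    x != y -> height x <= height y -> height x < height y.
  move=> xL yL xy; rewrite leq_eqVlt => /predU1P[exy|//].
  by rewrite exy in xL; rewrite (at_leg_uniq xL yL) eqxx in xy.
case/and3P=> /(lt _ _ x1L x2L x12) h12 /(lt _ _ x2L x3L x23) h23 _.
have [c [k cX]] : exists c k, {in Z, forall z, (z \in ball c k) = (z \in [set x1; x3])}.
  by apply: Z_cut; rewrite subUset !sub1set x1Z.
have := leg_convex x1L x2L x3L h12 h23.
move/(_ c k); rewrite !cX // !in_set2 !eqxx orbT [x2 == x1]eq_sym (negbTE x12) (negbTE x23).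
by move/(_ isT isT).
Qed.

Lemma card_legs : #|leg_of @: [set x in Z | ~~ is_set x]| <= 4.
Proof.
rewrite leqNgt; apply/negP; case/(imset_sorted_reps height)=> s [].
case: s => [|a [|u [|v [|p [|q [|? ?]]]]]] // s_uniq _ sZ s_sorted.
have sZi x : x \in [:: a; u; v; p; q] ->
    x \in Z /\ exists2 i, leg_of x = Some i & at_leg i (height x) (phi x).
  move/sZ; rewrite in_set => /andP[xZ xs]; split=> //.
  have: leg_of x != None by move: xs; rewrite /is_set /leg_of; case: (phi x) => // -[].
  by case E: (leg_of x) => [i|//] _; exists i => //; apply: leg_ofP.
have [aZ [ia ea aL]] := sZi a ltac:(by rewrite !in_cons eqxx ?orbT).
have [uZ [iu eu uL]] := sZi u ltac:(by rewrite !in_cons eqxx ?orbT).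
have [vZ [iv ev vL]] := sZi v ltac:(by rewrite !in_cons eqxx ?orbT).
have [pZ [ip ep pL]] := sZi p ltac:(by rewrite !in_cons eqxx ?orbT).
have [qZ [iq eq qL]] := sZi q ltac:(by rewrite !in_cons eqxx ?orbT).
have legs_uniq : uniq [:: ia; ip; iq; iu; iv].
  rewrite -(map_inj_uniq (@Some_inj _)) -(perm_uniq (s1 := map leg_of [:: a; u; v; p; q])) //.
  rewrite /= ea eu ev ep eq perm_cons.
  by rewrite (perm_catC [:: Some iu; Some iv] [:: Some ip; Some iq]).
have [K paK] := cut_connected aZ pZ.
have [c [k cX]] : exists c k, {in Z, forall z, (z \in ball c k) = (z \in [:: q; u; v])}.
  have [|c [k cX]] := Z_cut (X := [set x in [:: q; u; v]]).
    by apply/subsetP=> x; rewrite in_set !in_cons in_nil orbF => /or3P[] /eqP->.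
  by exists c, k => z zZ; rewrite cX // in_set.
move: s_sorted => /= /and5P[hau huv hvp hpq _].
have := legs_trace (c := c) (k := k) aL pL qL uL vL legs_uniq hpq _ paK.
rewrite !cX // !in_cons !in_nil !eqxx !orbT !orbF => /(_ _ isT isT isT).
have neq x y i j : leg_of x = Some i -> leg_of y = Some j -> i != j -> x == y = false.
  by move=> ex ey; apply: contraNF => /eqP exy; move: ey; rewrite -exy ex => -[->].
move: legs_uniq; rewrite /= !in_cons !in_nil !orbF !negb_or -!andbA.
case/and5P=> iap iaq iau iav /and5P[ipq ipu ipv _ _].
rewrite (neq _ _ _ _ ea eq iaq) (neq _ _ _ _ ea eu iau) (neq _ _ _ _ ea ev iav).
rewrite (neq _ _ _ _ ep eq ipq) (neq _ _ _ _ ep eu ipu) (neq _ _ _ _ ep ev ipv).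
suff le : [&& height a <= height q, height a <= height u & height a <= height v] by move/(_ le).
by move: hau huv hvp hpq; clear; lia.
Qed.

Lemma card_sets : #|[set x in Z | is_set x]| <= 7.
Proof.
set B := [set x in Z | is_set x]; rewrite leqNgt; apply/negP=> B8.
have BZ : {subset B <= Z} by move=> b; rewrite in_set => /andP[].
have Bset : {in B, forall b, is_set b} by move=> b; rewrite in_set => /andP[].
have B_conn b b' : b \in B -> b' \in B -> exists K, b' \in ball b K.
  by move=> /BZ bZ /BZ; apply: cut_connected.
have trace (X : {set H}) b1 b2 b3 : X \subset B -> b1 \in X -> b2 \in X ->
    b1 != b2 -> b3 \in B -> b3 \notin X ->
    exists2 Y : {set 'I_n}, #|Y| <= 2 &
      {in B, forall b, (b \in X) = [exists y in Y, y \in set_at b]}.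
  move=> XB b1X b2X b12 b3B b3X.
  have [|c [k cX]] := Z_cut (X := X).
    by apply/subsetP=> x /(subsetP XB) /BZ.
  have cXB b : b \in B -> (b \in ball c k) = (b \in X) by move/BZ; apply: cX.
  have [b1B b2B] := (subsetP XB _ b1X, subsetP XB _ b2X).
  have [|||Y Y2 cY] := set_trace Bset B_conn b1B b2B b3B b12 (c := c) (k := k).
  - by rewrite cXB.
  - by rewrite cXB.
  - by rewrite cXB.
  by exists Y => // b bB; rewrite -cXB // cY.
(* At least 7 sets are met by some Y with 2 elements, so one index lies in 4 of them. *)
have [y y4] : exists i, 3 < #|[set b in B | i \in set_at b]|.
  have /card_gt0P[b0 b0B] : 0 < #|B| by apply: leq_trans B8.
  have B7 : 6 < #|B :\ b0| by move: B8; rewrite (cardsD1 b0) b0B.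
  have /card_gt1P[b1 [b2 [b1B b2B b12]]] : 1 < #|B :\ b0| by apply: leq_trans B7.
  have [|Y Y2 XY] := trace _ _ _ _ (subsetDl B [set b0]) b1B b2B b12 b0B.
    by rewrite !inE eqxx.
  have [/existsP[y y3]|none] := boolP [exists i, 3 < #|[set b in B | i \in set_at b]|].
    by exists y.
  suff : 6 < 6 by [].
  apply: leq_trans B7 _; apply: (@leq_trans (\sum_(y in Y) 3)); last first.
    by rewrite sum_nat_const (leq_mul Y2 (leqnn 3)).
  have few i : #|[set b in B | i \in set_at b]| <= 3.
    by move: none; rewrite negb_exists => /forallP/(_ i); rewrite -leqNgt.
  apply: leq_trans (leq_sum _ (fun i _ => few i)).
  apply: leq_trans (card_bigcup_le _ _); apply: subset_leq_card.
  apply/subsetP=> b bX; have bB : b \in B by case/setD1P: bX.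
  move: bX; rewrite XY // => /exists_inP[y yY yb].
  by apply/bigcupP; exists y => //; rewrite in_set bB.
case/card_geqP: y4 => s [].
case: s => [|x1 [|x2 [|x3 [|x4 [|? ?]]]]] // s_uniq _ sF.
have sB x : x \in [:: x1; x2; x3; x4] -> x \in B /\ y \in set_at x.
  by move/sF; rewrite in_set => /andP.
have [x4B yx4] := sB x4 ltac:(by rewrite !in_cons eqxx ?orbT).
pose X := [set x in [:: x1; x2; x3]].
have X_sub x : x \in X -> x \in B /\ y \in set_at x.
  by rewrite in_set => xs; apply: sB; rewrite (mem_rcons [:: x1; x2; x3] x4) in_cons xs orbT.
have /andP[x4X X_uniq] : (x4 \notin [:: x1; x2; x3]) && uniq [:: x1; x2; x3].
  by rewrite -rcons_uniq.
have X3 : #|X| = 3 by rewrite cardsE; apply/card_uniqP.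
have [Y Y2 XY] : exists2 Y : {set 'I_n}, #|Y| <= 2 &
      {in B, forall b, (b \in X) = [exists y in Y, y \in set_at b]}.
  apply: (trace X x1 x2 x4) => //.
  - by apply/subsetP=> x /X_sub[].
  - by rewrite in_set mem_head.
  - by rewrite in_set !in_cons eqxx orbT.
  - by move: X_uniq => /= /andP[]; rewrite in_cons negb_or => /andP[].
  - by rewrite in_set.
have yY : y \notin Y.
  apply: contra x4X => yY; have : x4 \in X; last by rewrite in_set.
  by rewrite XY //; apply/exists_inP; exists y.
(* Sets of X contain y, which is not in Y, so they are pairs {y, i} with i in Y. *)
suff : #|X| <= 2 by rewrite X3.
apply: leq_trans Y2; rewrite -(card_imset _ phi_inj).
pose pair i : legged_clique := inr [set y; i].
apply: (@leq_trans #|pair @: Y|); last exact: leq_imset_card.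
apply: subset_leq_card; apply/subsetP=> _ /imsetP[x xX ->].
have [xB yx] := X_sub x xX.
move: (xX); rewrite XY // => /exists_inP[y' y'Y y'x].
apply/imsetP; exists y' => //; rewrite (is_setE (Bset _ xB)); congr inr.
apply/esym/eqP; rewrite eqEcard subUset !sub1set yx y'x /=.
rewrite cards2 (_ : y != y'); last by apply: contraNneq yY => ->.
have /card_gt1P[x' [x'' [x'X x''X x'x'']]] : 1 < #|X| by rewrite X3.
have [z zB zx] : exists2 z, z \in B & z != x.
  have [ex|] := eqVneq x' x; last by exists x' => //; case/X_sub: x'X.
  by exists x''; rewrite -?ex 1?eq_sym //; case/X_sub: x''X.
have [K zK] := B_conn _ _ xB zB.
by have [i [w [_ _ x2' _ _]]] := set_nbr (is_setE (Bset _ xB)) zK zx.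
Qed.

Lemma card_cut : #|Z| <= 15.
Proof.
rewrite -(cardsID [set x | is_set x] Z) (_ : 15 = 7 + 4 * 2) //; apply: leq_add.
  apply: leq_trans card_sets; apply: subset_leq_card.
  by apply/subsetP=> x; rewrite !in_set.
apply: (@leq_trans #|[set x in Z | ~~ is_set x]|).
  by apply: subset_leq_card; apply/subsetP=> x; rewrite !in_set andbC.
apply: leq_trans (card_le_fibers (f := leg_of) (m := 2) _) _; last first.
  by rewrite leq_mul2r card_legs.
case=> [i|]; last first.
  rewrite (_ : [set _ in _ | _] = set0) ?cards0 //; apply/setP=> x.
  by rewrite !in_set /is_set /leg_of; case: (phi x) => [[? ?]|?]; rewrite ?andbF.
apply: leq_trans (card_leg_fiber i); apply: subset_leq_card.
by apply/subsetP=> x; rewrite !in_set -andbA => /and3P[-> _ ->].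
Qed.

End Shattered.

End Subgraph.
End LeggedClique.

Lemma shattered_ball (G : sgraph) (Z : {set G}) :
    shattered (ball_hypergraph G) Z -> forall X : {set G}, X \subset Z ->
  exists c k, {in Z, forall z, (z \in ball c k) = (z \in X)}.
Proof.
move=> /forall_inP Z_sh X /Z_sh/exists_inP[_ /ball_hypergraphP[c [k ->]] /eqP eX].
by exists c, k => z zZ; rewrite -eX in_setI zZ andbT.
Qed.

Lemma distance_VC_dim_legged_clique n l : distance_VC_dim (legged_clique n l) <= 15.
Proof.
apply/bigmax_leqP => S _; apply/bigmax_leqP => Z /shattered_ball.
pose phi (x : induced S) : legged_clique n l := val x.
have phi_inj : injective phi by apply: val_inj.
have phi_adj x y : adj x y = legged_adj (phi x) (phi y) by [].
exact: (card_cut phi_inj phi_adj).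
Qed.

Section LowerBound.
Variables n l : nat.
Let G := legged_clique n l.+1.
Implicit Types i j : 'I_n.

Definition tip i : G := inl (i, ord_max).
Definition base i : G := inl (i, ord0).

Lemma tip_inj : injective tip. Proof. by move=> i j []. Qed.

Lemma tip_base i : tip i \in ball (base i) l.
Proof.
suff reach h (lt_h : h < l.+1) : (inl (i, Ordinal lt_h) : G) \in ball (base i) h.
  have -> : tip i = inl (i, Ordinal (ltnSn l)) by congr (inl (i, _)); apply: val_inj.
  exact: reach.
elim: h lt_h => [|h IHh] lt_h.
  by apply/ball0P; congr (inl (i, _)); apply: val_inj.
have step : adj (inl (i, Ordinal (ltnW lt_h)) : G) (inl (i, Ordinal lt_h)).
  by rewrite /= !eqxx.
by have := ball_trans (IHh _) (ball1 step); rewrite addn1.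
Qed.

Lemma tip_ball (e : {set 'I_n}) i :
  #|e| <= 2 -> (tip i \in ball (inr e : G) l.+1) = (i \in e).
Proof.
move=> e2; apply/idP/idP => [|ie].
  rewrite ball_sym => eb.
  have tipL : at_leg i l (tip i) by rewrite /= !eqxx.
  have off : ~~ on_leg i (inr e : G) by [].
  have [r [rL _ _]] := leg_root (phi := @id G) (fun _ _ => erefl) tipL off eb.
  rewrite subSnn => /ballSP[er|[z rz /ball0P ez]]; first by rewrite -er in rL.
  move: rz; rewrite -ez; case: r rL => // -[j h] /= /andP[/eqP-> _].
  by case/and3P.
apply: (@ball_trans G (base i) _ _ 1 l _ (tip_base i)).
by apply: ball1; rewrite /= ie e2.
Qed.

Lemma two_VC_dim_legged_clique : n <= two_VC_dim (ball_hypergraph_at G l.+1).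
Proof.
rewrite -[X in X <= _](card_ord n) -cardsT -(card_imset _ tip_inj).
apply: (@leq_bigmax_cond _ _ (fun X : {set G} => #|X|)).
apply/forall_inP=> X /andP[/subsetP X_tip /eqP X2].
pose e := [set i | tip i \in X].
have eX : tip @: e = X.
  apply/setP=> x; apply/imsetP/idP => [[i + ->]|xX]; first by rewrite in_set.
  by have /imsetP[i _ ex] := X_tip _ xX; exists i; rewrite // in_set -ex.
have e2 : #|e| <= 2 by rewrite -(card_imset _ tip_inj) eX X2.
apply/exists_inP; exists (ball (inr e : G) l.+1); first exact: imset_f.
apply/eqP/setP=> x; rewrite in_setI; apply/andP/idP => [[+ /imsetP[i _ ex]]|xX].
  by rewrite ex tip_ball // in_set.
split; last exact: X_tip.
by have /imsetP[i _ ex] := X_tip _ xX; rewrite ex tip_ball // in_set -ex.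
Qed.

End LowerBound.

Theorem theorem8 (n l : nat) (n_gt0 : 0 < n) (l_gt0 : 0 < l) :
  exists G : sgraph,
    distance_VC_dim G <= 18 /\ n <= two_VC_dim (ball_hypergraph_at G l).
Proof.
case: l l_gt0 => // l _; exists (legged_clique n l.+1); split.
  by apply: leq_trans (distance_VC_dim_legged_clique n l.+1) _.
exact: two_VC_dim_legged_clique.
Qed.
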